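(* Let $n\in\mathbb{N}$. Let $\widetilde{\mathcal{W}}$ be an affine Weyl group acting on $\mathbb{R}^n$ with fundamental domain a foldable figure $C$, let $\theta$ be an interior point of $C$, and let $A\in M_n(\mathbb{R})$ be an expansive matrix. Then there exists a $(D_{A,\theta},\widetilde{\mathcal{W}})$-wavelet set, i.e., a measurable set $E\subseteq\mathbb{R}^n$ such that (1) $E$ is $\widetilde{\mathcal{W}}$-congruent to $C$; and (2) $E$ generates a measurable partition of $\mathbb{R}^n$ under the action of the affine mapping $D_{A,\theta}(x):=A(x-\theta)+\theta$, that is, $\{D_{A,\theta}^k(E) : k\in\mathbb{Z}\}$ is a measurable partition of $\mathbb{R}^n$.
   Context: Measurable sets and null sets are with respect to Lebesgue measure on $\mathbb{R}^n$. A measurable partition of a measurable set $S$ is a countable family of measurable sets that are pairwise disjoint modulo null sets and whose union is $S$ modulo null sets. Expansive matrix: a real $n\times n$ matrix all of whose (complex) eigenvalues have modulus strictly greater than $1$. Root system: a finite set $R\subset\mathbb{R}^n\setminus\{0\}$ such that (R1) $R$ spans $\mathbb{R}^n$; (R2) for $\alpha\in R$, $t\alpha\in R$ if and only if $t=\pm1$; (R3) $r_\alpha(R)=R$ for all $\alpha\in R$, where $r_\alpha$ is the reflection through the linear hyperplane orthogonal to $\alpha$; (R4) $\langle\beta,\alpha^\vee\rangle\in\mathbb{Z}$ for all $\alpha,\beta\in R$, where $\alpha^\vee:=2\alpha/\langle\alpha,\alpha\rangle$. Affine Weyl group of $R$: the group $\widetilde{\mathcal{W}}:=\langle r_{\alpha,k}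 : \alpha\in R,\ k\in\mathbb{Z}\rangle$ generated by the reflections $r_{\alpha,k}(x)=r_\alpha(x)+k\,\alpha^\vee$ about the affine hyperplanes $H_{\alpha,k}=\{x\in\mathbb{R}^n : \langle x,\alpha\rangle=k\}$. Fundamental domain of $\widetilde{\mathcal{W}}$: a set $C\subset\mathbb{R}^n$ such that no $r\in\widetilde{\mathcal{W}}$ maps a point of $C$ to another (different) point of $C$, and for every $x\in\mathbb{R}^n$ there is $r\in\widetilde{\mathcal{W}}$ with $r(x)\in C$. Foldable figure: a compact connected subset $F$ of $\mathbb{R}^n$ for which there exists a finite set $\mathcal{S}$ of affine hyperplanes that cuts $F$ into finitely many congruent subfigures $F_1,\dots,F_m$, each similar to $F$, so that reflection in any of the cutting hyperplanes in $\mathcal{S}$ bounding $F_k$ takes it into some $F_\ell$. $\mathcal{G}$-congruence: for a countable group $\mathcal{G}$ of measurable bijections of $\mathbb{R}^n$ that map null sets to null sets, measurable sets $E,F$ are $\mathcal{G}$-congruent if there exist measurable partitions $\{E_g : g\in\mathcal{G}\}$ of $E$ and $\{F_g : g\in\mathcal{G}\}$ of $F$ such that $F_g=g(E_g)$ modulo null sets for all $g\in\mathcal{G}$. *)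

(* Defs.v *)
(* R^n is the space of column vectors 'cV[R]_n over R : realType, with its library
   topology. *)
From HB Require Import structures.
From mathcomp Require Import all_boot all_order all_algebra finmap.
From mathcomp Require Import complex.
From mathcomp Require Import all_classical all_reals all_analysis.

Set Implicit Arguments.
Unset Strict Implicit.
Unset Printing Implicit Defensive.

Import Order.TTheory GRing.Theory Num.Theory.
Import numFieldNormedType.Exports.

Local Open Scope classical_set_scope.
Local Open Scope ring_scope.

Section Lebesgue.
Variables (R : realType) (n : nat).
Local Notation V := 'cV[R]_n.
Implicit Types (X E F S : set V).

(* half-open box \prod_i [a_i, b_i[; empty as soon as some b_i <= a_i *)
Definition box (a b : V) : set V := [set x | forall i, a i 0 <= x i 0 < b i 0].

Definition box_volume (a b : V) : R := \prod_(i < n) Num.max 0 (b i 0 - a i 0).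

Definition lebesgue_outer (X : set V) : \bar R :=
  ereal_inf [set (\sum_(0 <= k <oo) (box_volume (ab k).1 (ab k).2)%:E)%E |
    ab in [set ab : nat -> V * V | X `<=` \bigcup_k box (ab k).1 (ab k).2]].

Definition lmeasurable (X : set V) : Prop := lebesgue_outer.-caratheodory X.

Definition lnull (X : set V) : Prop := lebesgue_outer X = 0%E.

Definition eq_mod_null (X Y : set V) : Prop :=
  lnull ((X `\` Y) `|` (Y `\` X)).

(* {P i : i in D} as an indexed family: a set occurring at two distinct
   indices has to be null. *)
Definition measurable_partition (I : Type) (D : set I) (P : I -> set V)
    (S : set V) : Prop :=
  [/\ countable D, lmeasurable S,
      forall i, D i -> lmeasurable (P i),
      forall i j, D i -> D j -> i <> j -> lnull (P i `&` P j)
    & eq_mod_null (\bigcup_(i in D) P i) S].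

Definition group_congruent (G : set (V -> V)) (E F : set V) : Prop :=
  exists EE FF : (V -> V) -> set V,
    [/\ measurable_partition G EE E, measurable_partition G FF F
      & forall g, G g -> eq_mod_null (FF g) (g @` EE g)].

End Lebesgue.

Section EuclideanGeometry.
Variables (R : realType) (n : nat).
Local Notation V := 'cV[R]_n.

Definition dot (x y : V) : R := \sum_(i < n) x i 0 * y i 0.

(* the Euclidean norm; the library norm on matrices is the max norm *)
Definition enorm (x : V) : R := Num.sqrt (dot x x).

Definition coroot (a : V) : V := (2 / dot a a) *: a.

Definition refl (a x : V) : V := x - dot x (coroot a) *: a.

(* reflection through the affine hyperplane [set x | dot x a = c], a != 0 *)
Definition affine_refl (a : V) (c : R) (x : V) : V := refl a x + c *: coroot a.

Definition hyperplane (a : V) (c : R) : set V := [set x | dot x a = c].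

Definition similar_with_ratio (r : R) (F P : set V) : Prop :=
  exists2 f : V -> V,
    (forall x y, enorm (f x - f y) = r * enorm (x - y)) & f @` F = P.

Definition similar (F P : set V) : Prop :=
  exists2 r : R, 0 < r & similar_with_ratio r F P.

Definition congruent (F P : set V) : Prop := similar_with_ratio 1 F P.

(* The subfigures into which the hyperplanes in S cut F: the closures of the
   connected components of what is left of F off these hyperplanes. *)
Definition pieces (S : set (set V)) (F : set V) : set (set V) :=
  let F' := F `\` \bigcup_(H in S) H in
  [set closure (connected_component F' x) | x in F'].

(* H contains an (n-1)-dimensional face of P, i.e. P `&` H has nonempty
   interior relative to H. *)
Definition bounds (H P : set V) : Prop :=
  exists U : set V, [/\ open U, U `&` H !=set0 & U `&` H `<=` P].

(* The cut is required to be genuine (at least two subfigures); S = set0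
   would otherwise make every compact connected set foldable. *)
Definition foldable_figure (F : set V) : Prop :=
  [/\ compact F, connected F &
    exists S : set (set V),
      [/\ finite_set S /\
            (forall H, S H -> exists a c, a != 0 /\ H = hyperplane a c),
          [/\ finite_set (pieces S F),
              exists P Q, [/\ pieces S F P, pieces S F Q & P <> Q]
            & \bigcup_(P in pieces S F) P = F],
          forall P Q, pieces S F P -> pieces S F Q -> congruent P Q,
          forall P, pieces S F P -> similar F P
        & forall P a c, pieces S F P -> a != 0 -> S (hyperplane a c) ->
            bounds (hyperplane a c) P ->
            exists2 Q, pieces S F Q & affine_refl a c @` P `<=` Q]].

Definition root_system (Phi : {fset V}) : Prop :=
  [/\ 0 \notin Phi,
      <<Phi>>%VS = fullv,
      forall (a : V) (t : R), a \in Phi ->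
        (t *: a \in Phi) <-> (t = 1 \/ t = -1),
      forall a : V, a \in Phi -> [fset refl a b | b in Phi]%fset = Phi
    & forall a b : V, a \in Phi -> b \in Phi ->
        dot b (coroot a) \is a Num.int].

Definition transformation_group (G : set (V -> V)) : Prop :=
  [/\ G idfun,
      forall g h, G g -> G h -> G (g \o h)
    & forall g, G g -> exists2 h, G h & cancel g h /\ cancel h g].

Definition affine_weyl_group (Phi : {fset V}) : set (V -> V) :=
  smallest transformation_group
    [set r | exists (a : V) (k : int), a \in Phi /\ r = affine_refl a k%:~R].

Definition fundamental_domain (G : set (V -> V)) (C : set V) : Prop :=
  (forall r x, G r -> C x -> C (r x) -> r x = x) /\
  (forall x, exists2 r, G r & C (r x)).

End EuclideanGeometry.

Section Dilation.
Variables (R : realType) (n : nat).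
Local Notation V := 'cV[R]_n.

Definition expansive (A : 'M[R]_n) : Prop :=
  forall z : R[i], eigenvalue (map_mx (real_complex R) A) z -> 1 < `|z|.

Definition dilation (A : 'M[R]_n) (theta x : V) : V :=
  A *m (x - theta) + theta.

(* D^k for k : int.  For invertible A (in particular, for expansive A) the
   inverse of x |-> A (x - theta) + theta is x |-> A^-1 (x - theta) + theta. *)
Definition dilation_power (A : 'M[R]_n) (theta : V) (k : int) : V -> V :=
  match k with
  | Posz m => iter m (dilation A theta)
  | Negz m => iter m.+1 (dilation (invmx A) theta)
  end.

Definition wavelet_set (A : 'M[R]_n) (theta : V) (W : set (V -> V))
    (C E : set V) : Prop :=
  [/\ lmeasurable E,
      group_congruent W E C
    & measurable_partition [set: int]
        (fun k => dilation_power A theta k @` E) [set: V]].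

End Dilation.

(* Main.v *)
Require Import Defs.
From HB Require Import structures.
From mathcomp Require Import all_boot all_order all_algebra finmap.
From mathcomp Require Import complex.
From mathcomp Require Import all_classical all_reals all_analysis.
From mathcomp Require Import ring lra.
Import Order.TTheory GRing.Theory Num.Theory.
Import numFieldNormedType.Exports.
Set Implicit Arguments.
Unset Strict Implicit.
Unset Printing Implicit Defensive.
Local Open Scope classical_set_scope.
Local Open Scope ring_scope.

(** Write [D] for the dilation about [theta] and [W] for the affine Weyl group.
    A set is a wavelet set if it is a transversal of the orbits of [D], up to a
    null set, and a rearrangement of [C] by [W]. Two sets come close to this.

    Since [A] is expansive, there is a norm that [A] increases by a factor at
    least [s > 1] ([expansive_adapted_norm]). Let the gauge [nu x] be this norm
    of [x - theta]. For [r > 0] the set [Y] of the [x] with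
    [nu x < r <= nu (D x)] meets each orbit of [D], except that of [theta],
    exactly once ([shell_packing], [shell_covering]); for [r] small it lies in
    [C], as [theta] is interior to [C]. So [Y] is a transversal of [D] and a
    part of [C].

    The group [W] contains the translations by the multiples of a coroot. A
    translate [X] of [C] by a large multiple lies between two levels of [nu]
    whose ratio is less than [s], so it meets each orbit of [D] at most once
    ([far_translate], [annulus_packing]). So [X] is a rearrangement of [C] by
    [W] and a partial transversal of [D].

    A Schroeder-Bernstein argument interpolates between both. The orbits define
    a partial injection from [X] to [Y], the translation maps [Y] into [X], and
    exchanging a suitable part of [X] for its trace on [Y] gives a set [E] that
    meets the same orbits as [Y] and that becomes [C] once its part in [X] is
    translated back ([simultaneous_transversal]). The pieces of [E] are moved
    by a translation and by the identity, and both partitions are exact, up to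
    the point [theta].

    All these sets are Borel, and Borel sets are Lebesgue measurable, because
    half-spaces satisfy the criterion of Caratheodory
    ([lmeasurable_halfspace]). The adapted norm rests on the geometric decay of
    the powers of the inverse of [A], deduced from the theorem of
    Cayley-Hamilton ([geometric_decay_matrix]). *)

(** * The Lebesgue outer measure *)

Section LebesgueOuterMeasure.
Context {R : realType}.

Lemma box_volume_ge0 n (a b : 'cV[R]_n) : 0 <= box_volume a b.
Proof. by apply: prodr_ge0 => i _; rewrite le_max lexx. Qed.

Lemma lebesgue_outer_ge0 n (X : set 'cV[R]_n) : (0 <= lebesgue_outer X)%E.
Proof.
apply: le_ereal_inf_tmp => _ [ab _ <-].
by apply: nneseries_ge0 => k _ _; rewrite lee_fin box_volume_ge0.
Qed.

Lemma le_lebesgue_outer n :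
  {homo @lebesgue_outer R n : X Y / X `<=` Y >-> (X <= Y)%E}.
Proof.
move=> X Y XY; apply: ereal_inf_le_tmp => _ [ab Yab <-].
by exists ab => //; apply: subset_trans XY Yab.
Qed.

Lemma lebesgue_outer_box n (a b : 'cV[R]_n.+1) (X : set 'cV[R]_n.+1) :
  X `<=` box a b -> (lebesgue_outer X <= (box_volume a b)%:E)%E.
Proof.
move=> Xab; apply: ereal_inf_lbound.
pose ab (k : nat) : 'cV[R]_n.+1 * 'cV[R]_n.+1 :=
  if k == 0%N then (a, b) else (0, 0).
exists ab => [x /Xab|]; first by exists 0%N.
rewrite (@nneseries_recl _ predT
  (fun k => (box_volume (ab k).1 (ab k).2)%:E))//=; last first.
  by move=> k _; rewrite lee_fin box_volume_ge0.
rewrite eseries0 ?adde0// => -[//|k] _ _ /=.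
by rewrite /box_volume big_ord_recl subrr maxxx mul0r.
Qed.

Lemma lebesgue_outer0 n : lebesgue_outer (set0 : set 'cV[R]_n.+1) = 0%E.
Proof.
apply/eqP; rewrite eq_le lebesgue_outer_ge0 andbT.
have -> : 0%E = (box_volume (0 : 'cV[R]_n.+1) 0)%:E.
  by rewrite /box_volume big_ord_recl subrr maxxx mul0r.
exact: lebesgue_outer_box.
Qed.

(** Cover the [k]-th set up to [e / 2 ^ k.+1]; the double sequence of boxes so
    obtained is a single sequence along a bijection of [nat] with [nat * nat]. *)
Lemma lebesgue_outer_sigma_subadditive n :
  sigma_subadditive (@lebesgue_outer R n).
Proof.
move=> X; have [[i ioo]|] := pselect (exists i, lebesgue_outer (X i) = +oo%E).
  rewrite (eseries_pinfty _ _ ioo) ?leey// => k _.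
  by rewrite -ltNye (lt_le_trans _ (lebesgue_outer_ge0 _)).
rewrite -forallNE => Xoo; apply/lee_addgt0Pr => _/posnumP[e].
rewrite (le_trans _ (epsilon_trick _ _ _))//; last first.
  by move=> k; exact: lebesgue_outer_ge0.
pose vol (ab : 'cV[R]_n * 'cV[R]_n) := (box_volume ab.1 ab.2)%:E.
have vol0 ab : (0 <= vol ab)%E by rewrite lee_fin box_volume_ge0.
have [G GP] : {G : nat -> nat -> 'cV[R]_n * 'cV[R]_n & forall k,
    X k `<=` \bigcup_j box (G k j).1 (G k j).2 /\
    (\sum_(j <oo) vol (G k j) <=
      lebesgue_outer (X k) + (e%:num / (2 ^ k.+1)%:R)%:E)%E}.
  apply: (@choice _ _ (fun k (ab : nat -> 'cV[R]_n * 'cV[R]_n) =>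
    X k `<=` \bigcup_j box (ab j).1 (ab j).2 /\
    (\sum_(j <oo) vol (ab j) <=
      lebesgue_outer (X k) + (e%:num / (2 ^ k.+1)%:R)%:E)%E)) => k.
  have ek : (0 < e%:num / (2 ^ k.+1)%:R)%R by [].
  have Xfin : lebesgue_outer (X k) \is a fin_num.
    by rewrite ge0_fin_numE ?lebesgue_outer_ge0// ltey; exact/eqP/Xoo.
  have [_ [ab Xab <-] /ltW le_ab] := lb_ereal_inf_adherent ek Xfin.
  by exists ab.
apply: (@le_trans _ _ (\sum_(i <oo) \sum_(j <oo) vol (G i j))%E); last first.
  by apply: lee_nneseries => [k _ _|k _]; [exact: nneseries_ge0|exact: (GP k).2].
rewrite (eq_eseriesr (g := fun i => \esum_(j in setT) vol (G i j))); last first.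
  by move=> i _; rewrite nneseries_esumT.
rewrite nneseries_esumT; last by move=> i; apply: esum_ge0 => j _; exact: vol0.
rewrite (@esum_esum _ _ _ setT (fun=> setT) (fun i j => vol (G i j)))//.
have /card_esym/ppcard_eqP[f] := card_nat2.
rewrite (_ : _ `*`` _ = setT); last by apply/seteqP; split.
rewrite (reindex_esum setT setT f)//.
apply: ereal_inf_lbound; exists (fun k => G (f k).1 (f k).2).
  move=> x [i _ /(GP i).1 [j _ Gx]].
  by exists (f^-1%FUN (i, j)) => //=; rewrite invK ?inE.
by rewrite nneseries_esumT => [|k]; [|exact: vol0].
Qed.

HB.instance Definition _ n := isOuterMeasure.Build R 'cV[R]_n.+1
  (@lebesgue_outer R n.+1) (lebesgue_outer0 n) (@lebesgue_outer_ge0 n.+1)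
  (@le_lebesgue_outer n.+1) (@lebesgue_outer_sigma_subadditive n.+1).

(** The identity stays true for empty boxes and for [c] outside of the [i]-th
    side, thanks to the truncation of side lengths at [0]. *)
Lemma box_volume_split n (i : 'I_n) (c : R) (a b : 'cV[R]_n) :
  box_volume a b =
    box_volume a (\col_j if j == i then Num.min (b j 0) c else b j 0) +
    box_volume (\col_j if j == i then Num.max (a j 0) c else a j 0) b.
Proof.
have D1 u v : box_volume u v = Num.max 0 (v i 0 - u i 0) *
    \prod_(j < n | j != i) Num.max 0 (v j 0 - u j 0).
  by rewrite /box_volume (bigD1 i).
rewrite !D1 !mxE eqxx.
have -> : \prod_(j < n | j != i)
    Num.max 0 ((\col_j if j == i then Num.min (b j 0) c else b j 0) j 0 - a j 0) =
    \prod_(j < n | j != i) Num.max 0 (b j 0 - a j 0).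
  by apply: eq_bigr => j ji; rewrite mxE (negbTE ji).
have -> : \prod_(j < n | j != i)
    Num.max 0 (b j 0 - (\col_j if j == i then Num.max (a j 0) c else a j 0) j 0) =
    \prod_(j < n | j != i) Num.max 0 (b j 0 - a j 0).
  by apply: eq_bigr => j ji; rewrite mxE (negbTE ji).
rewrite -mulrDl; congr (_ * _); move: (a i 0) (b i 0) => s t.
have [tc|ct] := leP t c; have [sc|cs] := leP s c.
- by rewrite (max_l (_ : t - c <= 0)) ?addr0// subr_le0.
- rewrite (max_l (_ : t - s <= 0)) ?addr0//; lra.
- by rewrite !max_r; lra.
- by rewrite (max_l (_ : c - s <= 0)) ?add0r//; lra.
Qed.

(** Cutting each box of a cover of [X] along the hyperplane gives covers of both
    parts of [X], of the same total volume by [box_volume_split]. *)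
Lemma lmeasurable_halfspace n (i : 'I_n.+1) (c : R) :
  lmeasurable [set x : 'cV[R]_n.+1 | x i 0 < c].
Proof.
apply: le_caratheodory_measurable => X.
apply: le_ereal_inf_tmp => _ [ab Xab <-].
pose lo k := \col_j if j == i then Num.min ((ab k).2 j 0) c else (ab k).2 j 0.
pose hi k := \col_j if j == i then Num.max ((ab k).1 j 0) c else (ab k).1 j 0.
under eq_eseriesr => k _ do rewrite (box_volume_split i c) EFinD.
rewrite nneseriesD//; try by move=> *; rewrite lee_fin box_volume_ge0.
apply: leeD; apply: ereal_inf_lbound.
  exists (fun k => ((ab k).1, lo k)) => // x [/Xab[k _ xk] xc].
  exists k => //= j; rewrite mxE; have /andP[-> /= xb] := xk j.
  by case: eqP => // ji; rewrite lt_min xb ji.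
exists (fun k => (hi k, (ab k).2)) => // x [/Xab[k _ xk] /negP xc].
exists k => //= j; rewrite mxE; have /andP[/= ax ->] := xk j.
by rewrite andbT; case: eqP => // ji; rewrite ge_max ax leNgt ji xc.
Qed.

Lemma sigma_algebra_lmeasurable n :
  sigma_algebra setT (@lmeasurable R n.+1).
Proof.
split.
- exact: caratheodory_measurable_set0.
- by move=> X mX; rewrite setTD; exact: caratheodory_measurable_setC.
- by move=> F mF; exact: caratheodory_measurable_bigcup.
Qed.

Lemma lmeasurable_box n (a b : 'cV[R]_n.+1) : lmeasurable (box a b).
Proof.
(* [inord] turns the union over the coordinates into one over [nat]. *)
have -> : box a b = ~` (\bigcup_k
    let H c := [set x | x (inord k) 0 < c (inord k) 0] in H a `|` ~` H b).
  apply/seteqP; split => [x xab [k _ [|]]|x xab i] /=.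
  - by have /andP[ax _] := xab (inord k); rewrite ltNge ax.
  - by have /andP[_ xb] := xab (inord k); apply.
  - apply/andP; split; [rewrite leNgt; apply/negP => xa|apply: contrapT => xb];
    apply: xab; exists i => //=; rewrite inord_val; [by left|by right].
apply: caratheodory_measurable_setC; apply: caratheodory_measurable_bigcup => k.
apply: caratheodory_measurable_setU; first exact: lmeasurable_halfspace.
by apply: caratheodory_measurable_setC; exact: lmeasurable_halfspace.
Qed.

(** An open set is the union of the countably many boxes with rational corners
    that it contains. *)
Lemma lmeasurable_open n (U : set 'cV[R]_n.+1) : open U -> lmeasurable U.
Proof.
move=> oU; pose rbox (ab : 'cV[rat]_n.+1 * 'cV[rat]_n.+1) : set 'cV[R]_n.+1 :=
  box (map_mx ratr ab.1) (map_mx ratr ab.2).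
pose F (k : nat) :=
  if @choice.unpickle ('cV[rat]_n.+1 * 'cV[rat]_n.+1)%type k is Some ab then
  if pselect (rbox ab `<=` U) then rbox ab else set0 else set0.
have -> : U = \bigcup_k F k.
  apply/seteqP; split => [x Ux|x [k _]]; last first.
    by rewrite /F; case: choice.unpickle => // ab; case: pselect => // abU /abU.
  have /nbhs_ballP[e /= e0 xeU] : nbhs x U by exact: open_nbhs_nbhs.
  have exa i : exists q : rat, x i 0 - e < ratr q < x i 0.
    have [|q] := @rat_in_itvoo R (x i 0 - e) (x i 0); first by rewrite ltrBlDr ltrDl.
    by rewrite in_itv; exists q.
  have exb i : exists q : rat, x i 0 < ratr q < x i 0 + e.
    have [|q] := @rat_in_itvoo R (x i 0) (x i 0 + e); first by rewrite ltrDl.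
    by rewrite in_itv; exists q.
  have [a aP] := choice exa; have [b bP] := choice exb.
  exists (choice.pickle (\col_i a i, \col_i b i)) => //; rewrite /F choice.pickleK.
  case: pselect => [_ i|[]] /=.
    by rewrite !mxE; have /andP[_ /ltW->] := aP i; have /andP[-> _] := bP i.
  move=> y yab; apply: xeU; split=> // i j; rewrite ord1.
  have := yab i; rewrite !mxE => /andP[ay yb].
  have /andP[ea _] := aP i; have /andP[_ eb] := bP i.
  rewrite /ball /= ltr_distlC; apply/andP; split; lra.
apply: caratheodory_measurable_bigcup => k; rewrite /F.
case: choice.unpickle => [ab|]; last exact: caratheodory_measurable_set0.
by case: pselect => ?; [exact: lmeasurable_box|exact: caratheodory_measurable_set0].
Qed.

Lemma lnull_set0 n : lnull (set0 : set 'cV[R]_n.+1).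
Proof. exact: lebesgue_outer0. Qed.

Lemma lnull_set1 n (x : 'cV[R]_n.+1) : lnull [set x].
Proof.
apply/eqP; rewrite /lnull eq_le lebesgue_outer_ge0 andbT.
apply/lee_addgt0Pr => e e0; rewrite add0e.
pose d := Num.min 1 e.
have d0 : 0 < d by rewrite lt_min ltr01.
apply: (@le_trans _ _ (box_volume x (x + const_mx d))%:E).
  by apply: lebesgue_outer_box => _ -> i; rewrite !mxE lexx ltrDl.
rewrite lee_fin /box_volume big_ord_recl !mxE addrAC subrr add0r.
rewrite max_r; last exact: ltW.
apply: (@le_trans _ _ d); last by rewrite ge_min lexx orbT.
rewrite ler_piMr ?(ltW d0)//; apply: prodr_ile1 => i _.
by rewrite !mxE addrAC subrr add0r le_max lexx ge_max ler01 ge_min lexx.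
Qed.

Lemma eq_mod_null_refl n (X : set 'cV[R]_n.+1) : eq_mod_null X X.
Proof. by rewrite /eq_mod_null setDv setU0; exact: lnull_set0. Qed.

End LebesgueOuterMeasure.

(** * Expansive matrices and an adapted norm *)

Section ExpansiveMatrices.
Context {R : realType}.
Local Notation normc := (@ComplexField.Normc.normc R).

Let normc_ge0 (z : R[i]) : 0 <= normc z.
Proof. by case: z => a b; exact: sqrtr_ge0. Qed.

Definition geometric_decay (u : nat -> R[i]) :=
  exists rho c : R, 0 <= rho < 1 /\ forall k, normc (u k) <= c * rho ^+ k.

(** With [r] between the two rates, [c' * r ^+ k] absorbs the forcing term as
    soon as [c <= (r - normc z) * c']. Enlarging the rate avoids the resonant
    case in which [z] has modulus [rho]. *)
Lemma geometric_decay_recurrence (z : R[i]) (u e : nat -> R[i]) :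
  normc z < 1 -> (forall k, u k.+1 = z * u k + e k) ->
  geometric_decay e -> geometric_decay u.
Proof.
move=> z1 ue [rho [c [/andP[rho0 rho1] ec]]].
pose r := Num.max ((1 + normc z) / 2) rho.
have zr : normc z < r by rewrite lt_max; apply/orP; left; lra.
have r1 : r < 1 by rewrite gt_max rho1 andbT; lra.
have r0 : 0 <= r by rewrite le_max rho0 orbT.
have rhor : rho <= r by rewrite le_max lexx orbT.
have c0 : 0 <= c.
  by have := ec 0%N; rewrite mulr1; apply: le_trans; exact: normc_ge0.
pose c' := Num.max (normc (u 0%N)) (c / (r - normc z)).
exists r, c'; split=> [|k]; first by rewrite r0.
elim: k => [|k IH]; first by rewrite mulr1 le_max lexx.
rewrite ue; apply: le_trans (le_normcD _ _) _.
rewrite ComplexField.Normc.normcM.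
have cc' : c <= (r - normc z) * c'.
  by rewrite mulrC -ler_pdivrMr ?subr_gt0// le_max lexx orbT.
apply: (@le_trans _ _ (normc z * (c' * r ^+ k) + (r - normc z) * c' * r ^+ k)).
  apply: lerD; first by apply: ler_wpM2l => //; exact: normc_ge0.
  apply: le_trans (ec k) _; apply: ler_pM => //; first exact: exprn_ge0.
  exact: lerXn2r.
by rewrite exprS; lra.
Qed.

(** By Cayley-Hamilton the product of the [B - z%:M] over the eigenvalues
    vanishes. Its factors are removed one at a time: the sequence that lacks the
    factor [B - z%:M] solves a first-order recurrence of ratio [z] whose forcing
    term is the sequence with that factor. *)
Lemma geometric_decay_matrix n (B : 'M[R[i]]_n.+1) :
  (forall z, eigenvalue B z -> normc z < 1) ->
  forall i j, geometric_decay (fun k => (B ^+ k) i j).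
Proof.
move=> B1; have [s sE] := closed_field_poly_normal (char_poly B).
rewrite (monicP (char_poly_monic B)) scale1r in sE.
have B0 : \prod_(z <- s) (B - z%:M) = 0.
  rewrite -(Cayley_Hamilton B) sE rmorph_prod; apply: eq_bigr => z _.
  by rewrite rmorphB /= horner_mx_X horner_mx_C.
have s1 : {in s, forall z, normc z < 1}.
  by move=> z zs; apply: B1; rewrite eigenvalue_root_char sE root_prod_XsubC.
have : forall i j, geometric_decay
    (fun k => (B ^+ k * \prod_(z <- s) (B - z%:M)) i j).
  move=> i j; exists 0, 0; split=> [|k]; first by rewrite lexx ltr01.
  by rewrite B0 mulr0 mxE ComplexField.Normc.normc0 mul0r.
elim: s s1 {sE B0} => [|z s IH] s1 dB i j.
  by have := dB i j; under [X in geometric_decay X]eq_fun do rewrite big_nil mulr1.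
apply: IH => [w ws|{}i {}j]; first by apply: s1; rewrite inE ws orbT.
apply: (@geometric_decay_recurrence z) (dB i j) => [|k].
  by apply: s1; rewrite mem_head.
rewrite big_cons mulrA mulrBr -exprSr mulrBl [X in _ = _ + X]mxE.
rewrite [X in _ = _ + (_ + X)]mxE.
by rewrite -scalemx1 -scalerAr mulr1 -scalerAl [X in _ - X]mxE addrC subrK.
Qed.

Lemma expansive_unitmx n (A : 'M[R]_n) : expansive A -> A \in unitmx.
Proof.
move=> eA; have [//|A0] := boolP (A \in unitmx).
suff /eA : eigenvalue (map_mx (real_complex R) A) 0 by rewrite normr0 ltr10.
rewrite /eigenvalue /eigenspace raddf0 subr0 kermx_eq0 row_free_unit.
by rewrite map_unitmx.
Qed.

(** An eigenvalue [z] of the inverse is nonzero and [z^-1] is one of [A], so it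
    has modulus less than [1]. *)
Lemma expansive_inv_pow n (A : 'M[R]_n.+1) : expansive A ->
  forall i j, exists rho c : R, 0 <= rho < 1 /\
    forall k, `|(invmx A ^+ k) i j| <= c * rho ^+ k.
Proof.
move=> eA i j; have uA := expansive_unitmx eA.
pose A' := map_mx (real_complex R) A.
have uA' : A' \in unitmx by rewrite map_unitmx.
have [|rho [c [rho01 rhoc]]] := @geometric_decay_matrix n (invmx A') _ i j.
  move=> z /eigenvalueP[v vz v0].
  have vE : v = z *: (v *m A') by rewrite scalemxAl -vz mulmxKV.
  have z0 : z != 0 by apply: contraNneq v0 => z0; rewrite vE z0 scale0r.
  have /eA : eigenvalue A' z^-1.
    by apply/eigenvalueP; exists v => //; rewrite {2}vE scalerA mulVf// scale1r.
  rewrite (_ : `|z^-1| = (normc z^-1)%:C%C)// (ltcR 1).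
  rewrite ComplexField.Normc.normcV invf_gt1//.
  rewrite lt_neqAle normc_ge0 andbT eq_sym; apply: contraNneq z0.
  by move/ComplexField.Normc.eq0_normc ->.
exists rho, c; split=> // k; have := rhoc k.
rewrite -map_invmx -rmorphXn mxE.
by rewrite /ComplexField.Normc.normc /= expr0n addr0 sqrtr_sqr.
Qed.

Lemma ler_coord_norm n (y : 'cV[R]_n) i : `|y i 0| <= `|y|.
Proof.
rewrite [leRHS]/Num.norm /= mx_normrE.
by apply/bigmax_geP; right; exists (i, 0).
Qed.

Lemma norm_mulmx_le n (M : 'M[R]_n) (e : R) (y : 'cV[R]_n) : 0 <= e ->
  (forall i j, `|M i j| <= e) -> `|M *m y| <= n%:R * e * `|y|.
Proof.
move=> e0 Me; rewrite [leLHS]/Num.norm /= mx_normrE; apply/bigmax_leP; split=> /=.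
  by rewrite !mulr_ge0.
move=> [i j] _ /=; rewrite ord1 mxE; apply: le_trans (ler_norm_sum _ _ _) _.
rewrite -mulrA mulr_natl -[X in _ *+ X]card_ord -sumr_const; apply: ler_sum => k _.
by rewrite normrM; apply: ler_pM => //; exact: ler_coord_norm.
Qed.

Lemma mulmx_bounded n (M : 'M[R]_n) :
  exists c : R, forall y : 'cV[R]_n, `|M *m y| <= c * `|y|.
Proof.
exists (n%:R * `|M|) => y; apply: norm_mulmx_le => // i j.
rewrite [leRHS]/Num.norm /= mx_normrE.
by apply/bigmax_geP; right; exists (i, j).
Qed.

Lemma expansive_inv_halves n (A : 'M[R]_n.+1) : expansive A ->
  exists m, forall y : 'cV[R]_n.+1, `|invmx A ^+ m.+1 *m y| <= `|y| / 2.
Proof.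
move=> eA; pose e : R := n.+1%:R^-1 / 2.
have e0 : 0 < e by rewrite divr_gt0.
have small i j : \forall k \near \oo, `|(invmx A ^+ k) i j| <= e.
  have [rho [c [/andP[rho0 rho1] rhoc]]] := expansive_inv_pow eA i j.
  have c0 : (fun k => c * rho ^+ k) @ \oo --> (0 : R).
    rewrite -(mulr0 c); apply: cvgMr; apply: cvg_expr.
    by rewrite ger0_norm.
  move/cvgrPdist_le : c0 => /(_ _ e0); apply: filterS => k.
  rewrite sub0r normrN => ck; apply: le_trans (rhoc k) (le_trans _ ck).
  exact: ler_norm.
have [N _ NP] : \forall k \near \oo, forall ij : 'I_n.+1 * 'I_n.+1,
    `|(invmx A ^+ k) ij.1 ij.2| <= e.
  by apply: filter_forall => -[i j]; exact: small.
exists N => y; rewrite (_ : _ / 2 = n.+1%:R * e * `|y|).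
  apply: norm_mulmx_le (ltW e0) _ => i j; apply: (NP N.+1 _ (i, j)).
  exact: leqnSn.
by rewrite /e mulrA mulfV// mul1r mulrC.
Qed.

(** A norm adapted to [A]. If the [m]-th power of the inverse [B] halves norms,
    then the sum of the [(m + j) * `|B ^+ j *m y|] for [j < m] works, with ratio
    [2 * m / (2 * m - 1)]: replacing [y] by [B *m y] shifts the summands, and
    the weights satisfy [2 * m * (m + j) <= (2 * m - 1) * (m + j + 1)], while
    the summand of index [m] that appears is at most half of the one of index
    [0] that is lost. *)
Lemma expansive_adapted_norm n (A : 'M[R]_n.+1) : expansive A ->
  exists (N : 'cV[R]_n.+1 -> R) (s K : R),
  [/\ 1 < s,
      forall y, `|y| <= N y <= K * `|y|,
      forall y z, N (y + z) <= N y + N z,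
      forall y, N (- y) = N y
    & forall y, s * N y <= N (A *m y)].
Proof.
move=> eA; have [p pP] := expansive_inv_halves eA.
pose m : R := p.+1%:R; pose B := invmx A.
pose N (y : 'cV[R]_n.+1) := \sum_(j < p.+1) (m + j%:R) * `|B ^+ j *m y|.
have m1 : 1 <= m by rewrite ler1n.
have w0 (j : nat) : 0 <= m + j%:R by rewrite addr_ge0.
have NB y : 2 * m * N (B *m y) <= (2 * m - 1) * N y.
  pose a (j : nat) := `|B ^+ j *m y|.
  have aS (j : nat) : `|B ^+ j *m (B *m y)| = a j.+1.
    by rewrite mulmxA -[B ^+ j *m B]/(B ^+ j * B) -exprSr.
  have ap : a p.+1 <= a 0%N / 2 by rewrite /a expr0 mul1mx; exact: pP.
  rewrite /N; under eq_bigr => j _ do rewrite aS.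
  rewrite big_ord_recr /= [in leRHS]big_ord_recl /= addr0 -/(a 0%N).
  rewrite addrC mulrDr [leRHS]mulrDr; apply: lerD.
    have : 2 * m * (2 * m - 1) * a p.+1 <= 2 * m * (2 * m - 1) * (a 0%N / 2).
      by apply: ler_wpM2l => //; apply: mulr_ge0; lra.
    have -> : m + p%:R = 2 * m - 1 by rewrite /m -natr1; lra.
    by lra.
  rewrite !mulr_sumr; apply: ler_sum => j _; rewrite !mulrA -/(a _).
  apply: ler_wpM2r; first exact: normr_ge0.
  rewrite /bump add1n -natr1.
  have : j%:R + 1 <= m by rewrite natr1 ler_nat; exact: leqW.
  by nra.
have [K KP] := choice (fun j => mulmx_bounded (B ^+ j)).
exists N, (2 * m / (2 * m - 1)), (\sum_(j < p.+1) (m + j%:R) * K j); split.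
- by rewrite ltr_pdivlMr; lra.
- move=> y; apply/andP; split.
    rewrite /N big_ord_recl /= expr0 mul1mx addr0.
    apply: (@le_trans _ _ (m * `|y|)); first exact: ler_peMl.
    by rewrite lerDl; apply: sumr_ge0 => j _; rewrite mulr_ge0.
  by rewrite mulr_suml; apply: ler_sum => j _; rewrite -mulrA ler_wpM2l.
- move=> y z; rewrite -big_split /=; apply: ler_sum => j _.
  by rewrite -mulrDr ler_wpM2l// mulmxDr ler_normD.
- by move=> y; apply: eq_bigr => j _; rewrite mulmxN normrN.
- move=> y; have := NB (A *m y); rewrite mulKmx ?expansive_unitmx// => H.
  by rewrite mulrAC ler_pdivrMr 1?mulrC//; lra.
Qed.
End ExpansiveMatrices.

(** * Borel sets *)

Section BorelSets.
Context {T : ptopologicalType}.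
Local Notation borel := <<s (@open T) >>.
Let M := g_sigma_algebraType (@open T).

Lemma borel_open (U : set T) : open U -> borel U.
Proof. exact: sub_sigma_algebra. Qed.

Lemma borel_closed (F : set T) : closed F -> borel F.
Proof.
move=> cF; rewrite -(setCK F); apply: (@measurableC _ M).
by apply: borel_open; exact: closed_openC.
Qed.

Lemma borel_setD (X Y : set T) : borel X -> borel Y -> borel (X `\` Y).
Proof. exact: (@measurableD _ M). Qed.

Lemma borel_setI (X Y : set T) : borel X -> borel Y -> borel (X `&` Y).
Proof. exact: (@measurableI _ M). Qed.

Lemma borel_setU (X Y : set T) : borel X -> borel Y -> borel (X `|` Y).
Proof. exact: (@measurableU _ M). Qed.

Lemma borel_bigcup (I : countType) (F : I -> set T) :
  (forall i, borel (F i)) -> borel (\bigcup_i F i).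
Proof. by move=> F_; apply: (@countable_bigcupT_measurable _ M). Qed.

Lemma borel_preimage (f : T -> T) (X : set T) :
  continuous f -> borel X -> borel (f @^-1` X).
Proof.
move=> cf; suff: borel `<=` [set X | borel (f @^-1` X)] by apply.
apply: smallest_sub => [|U oU]; last by apply: borel_open; move/continuousP: cf; exact.
split=> [|Y bY|F bF]; rewrite /= ?preimage_set0 ?preimage_bigcup.
- exact: (@measurable0 _ M).
- by rewrite setTD; apply: (@measurableC _ M).
- exact: (@bigcupT_measurable _ M).
Qed.
End BorelSets.

(** * A common transversal, by a Schroeder-Bernstein exchange *)

Lemma image_can (T : Type) (f g : T -> T) :
  cancel f g -> cancel g f -> forall S : set T, f @` S = g @^-1` S.
Proof.
move=> fK gK S; apply/seteqP.
by split=> [_ [x Sx <-]|x Sx]; [rewrite /= fK|exists (g x)].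
Qed.

Section SimultaneousTransversal.
Context {V : Type}.
Variables (T : int -> V -> V) (q : V -> V) (X Y : set V).
Hypothesis T0 : forall x, T 0 x = x.
Hypothesis TD : forall k l x, T (k + l) x = T k (T l x).
Hypothesis q_inj : injective q.
Hypothesis qYX : q @` Y `<=` X.
Hypothesis X_packing : forall x k, X x -> X (T k x) -> k = 0.
Hypothesis Y_packing : forall x k, Y x -> Y (T k x) -> k = 0.

Definition orbit_trace (S : set V) : set V := Y `&` \bigcup_k T k @` S.

Definition exchange_set : set V :=
  \bigcup_m iter m (fun S => q @` orbit_trace S) (X `\` q @` Y).

(** The translates of [x] under [T] form its orbit, and [X] and [Y] meet every
    orbit at most once. Sending a point of [X] to the point of [Y] on its orbit
    is a partial injection from [X] to [Y], whereas [q] injects [Y] into [X]: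
    [exchange_set] is the set along which the Schroeder-Bernstein bijection
    follows the first of them, and [simultaneous_transversal] exchanges it for
    its trace on [Y]. The result meets the same orbits as [Y], and pulling its
    part in [exchange_set] back by [q] makes it a rearrangement of [X]. *)
Definition simultaneous_transversal : set V :=
  exchange_set `|` (Y `\` orbit_trace exchange_set).

Lemma exchange_set_fixpoint :
  exchange_set = (X `\` q @` Y) `|` q @` orbit_trace exchange_set.
Proof.
apply/seteqP; split=> [x [[|m] _ mx]|x [Xx|[y [Yy [k _ [z [m _ mz] zy]]] <-]]].
- by left.
- right; case: mx => y [Yy [k _ [z mz zy]]] <-; exists y => //; split=> //.
  by exists k => //; exists z => //; exists m.
- by exists 0%N.
- by exists m.+1 => //; exists y => //; split=> //; exists k => //; exists z.
Qed.

Lemma exchange_set_sub : exchange_set `<=` X.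
Proof.
rewrite exchange_set_fixpoint => x [[]//|[y [Yy _] <-]].
by apply: qYX; exists y.
Qed.

Lemma exchange_setD :
  X `\` exchange_set = q @` (Y `\` orbit_trace exchange_set).
Proof.
apply/seteqP; split=> [x [Xx nx]|_ [y [Yy ny] <-]].
  have [y Yy yx] : (q @` Y) x.
    by apply: contrapT => xY; apply: nx; rewrite exchange_set_fixpoint; left.
  exists y => //; split=> // yS; apply: nx.
  by rewrite exchange_set_fixpoint; right; exists y.
split; first by apply: qYX; exists y.
rewrite exchange_set_fixpoint => -[[_]|[z zS /q_inj zy]].
  by apply; exists y.
by apply: ny; rewrite -zy.
Qed.

(** A point of [exchange_set] and a point of its complement in the transversal
    never share an orbit, since the latter lies in [Y] off the orbit trace. *)
Lemma simultaneous_transversal_packing x k :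
  simultaneous_transversal x -> simultaneous_transversal (T k x) -> k = 0.
Proof.
have TK l y : T (- l) (T l y) = y by rewrite -TD addNr T0.
move=> [Sx|[Yx nx]] [Skx|[Ykx nkx]].
- by apply: (X_packing (x := x)); exact: exchange_set_sub.
- by case: nkx; split=> //; exists k => //; exists x.
- by case: nx; split=> //; exists (- k) => //; exists (T k x).
- exact: Y_packing Ykx.
Qed.

Lemma simultaneous_transversal_covering x k :
  Y (T k x) -> exists l, simultaneous_transversal (T l x).
Proof.
move=> Ykx.
have [[_ [l _ [z Sz zx]]]|nS] := pselect (orbit_trace exchange_set (T k x)).
  exists (- l + k); left; rewrite TD -zx -TD addNr T0; exact: Sz.
by exists k; right.
Qed.

End SimultaneousTransversal.

(** All the operations that produce the exchange set are countable unions and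
    images by homeomorphisms, that is, preimages by continuous maps. *)
Lemma borel_exchange_set (T : ptopologicalType) (D : int -> T -> T)
    (q q' : T -> T) (X Y : set T) :
  (forall k, continuous (D k)) -> (forall k, cancel (D (- k)) (D k)) ->
  continuous q' -> cancel q q' -> cancel q' q ->
  <<s open >> X -> <<s open >> Y ->
  <<s open >> (exchange_set D q X Y) /\
  <<s open >> (orbit_trace D Y (exchange_set D q X Y)).
Proof.
move=> cD DK cq' qK q'K bX bY.
have DE k (S : set T) : D k @` S = D (- k) @^-1` S.
  by apply: image_can => // x; rewrite -{2}(opprK k) DK.
have trace S : <<s open >> S -> <<s open >> (orbit_trace D Y S).
  move=> bS; apply: borel_setI => //; apply: borel_bigcup => k.
  by rewrite DE; exact: borel_preimage.
suff bE : <<s open >> (exchange_set D q X Y) by split=> //; exact: trace.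
apply: borel_bigcup => m; elim: m => [|m IH].
  by apply: borel_setD => //; rewrite (image_can qK q'K); exact: borel_preimage.
by rewrite iterS (image_can qK q'K); apply: borel_preimage => //; exact: trace.
Qed.

(** * The affine Weyl group *)

Section AffineWeylGroup.
Context {R : realType} {n : nat}.
Local Notation V := 'cV[R]_n.
Implicit Types (a x y : V) (c : R).

Lemma dotDl x y a : dot (x + y) a = dot x a + dot y a.
Proof. by rewrite -big_split; apply: eq_bigr => i _; rewrite !mxE mulrDl. Qed.

Lemma dotZl c x a : dot (c *: x) a = c * dot x a.
Proof. by rewrite [RHS]mulr_sumr; apply: eq_bigr => i _; rewrite !mxE mulrA. Qed.

Lemma dotC x y : dot x y = dot y x.
Proof. by apply: eq_bigr => i _; rewrite mulrC. Qed.

Lemma dot_eq0 a : a != 0 -> dot a a != 0.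
Proof.
apply: contraNneq => /eqP; rewrite psumr_eq0; last by move=> i _; exact: sqr_ge0.
move=> /allP a0; apply/eqP/matrixP => i j; rewrite ord1 mxE.
by have := a0 i; rewrite mem_index_enum mulf_eq0 orbb => /(_ isT)/eqP.
Qed.

Lemma dot_coroot a : a != 0 -> dot a (coroot a) = 2.
Proof. by move=> a0; rewrite dotC dotZl mulfVK ?dot_eq0. Qed.

Lemma coroot_neq0 a : a != 0 -> coroot a != 0.
Proof.
move=> a0; rewrite scaler_eq0 negb_or a0 andbT mulf_neq0// invr_eq0.
exact: dot_eq0.
Qed.

(** Reflections in two parallel hyperplanes compose to a translation; for
    [c = d] this says that a reflection is an involution. *)
Lemma affine_refl_comp a c d x : a != 0 ->
  affine_refl a c (affine_refl a d x) = x + (c - d) *: coroot a.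
Proof.
move=> a0; have a2 := dot_eq0 a0.
rewrite /affine_refl /refl !(dotDl, dotZl) -scaleNr dotZl dot_coroot//.
rewrite /coroot; apply/matrixP => i j; rewrite !mxE; field.
exact: a2.
Qed.

Lemma affine_weyl_translation (Phi : {fset V}) a (k : int) :
  a \in Phi -> a != 0 ->
  affine_weyl_group Phi (fun x => x + k%:~R *: coroot a).
Proof.
move=> aPhi a0 G [[_ Gcomp _] Ggen].
have -> : (fun x => x + k%:~R *: coroot a) =
    affine_refl a k%:~R \o affine_refl a 0.
  by apply/funext => x /=; rewrite affine_refl_comp// subr0.
by apply: Gcomp; apply: Ggen; [exists a, k|exists a, 0].
Qed.

Lemma affine_weyl_idfun (Phi : {fset V}) : affine_weyl_group Phi idfun.
Proof. by move=> G [[]]. Qed.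

(** The words in the generators form a countable transformation group, the
    inverse of a word being the reversed word, and this group contains the
    affine Weyl group. *)
Lemma countable_affine_weyl_group (Phi : {fset V}) :
  0 \notin Phi -> countable (affine_weyl_group Phi).
Proof.
move=> Phi0.
pose word (w : seq (Phi * int)) : V -> V :=
  foldr (fun p f => affine_refl (val p.1) p.2%:~R \o f) idfun w.
have word_cat u v : word (u ++ v) = word u \o word v.
  by elim: u => [|p u IH] //=; rewrite IH.
have reflK (p : Phi * int) :
    cancel (affine_refl (val p.1) p.2%:~R) (affine_refl (val p.1) p.2%:~R).
  move=> x; rewrite affine_refl_comp ?subrr ?scale0r ?addr0//.
  by apply: contraNneq Phi0 => <-; exact: valP.
apply: (@sub_countable _ _ _ (range word)); last first.
  exact: sub_countable (card_image_le _ _) (countableP _).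
apply: subset_card_le; apply: smallest_sub; last first.
  by move=> _ [a [k [aPhi ->]]]; exists [:: ([` aPhi]%fset, k)].
split; first by exists [::].
  by move=> _ _ [u _ <-] [v _ <-]; exists (u ++ v).
move=> _ [w _ <-]; exists (word (rev w)); first by exists (rev w).
elim: w => [//|p w [IH1 IH2]]; rewrite rev_cons -cats1 word_cat.
split=> x /=.
  by rewrite reflK IH1.
by rewrite IH2 reflK.
Qed.

Lemma root_system_has_root (Phi : {fset V}) : (0 < n)%N ->
  root_system Phi -> exists2 a, a \in Phi & a != 0.
Proof.
move=> n0 [Phi0 Phispan _ _ _].
have [a aPhi|Phi_empty] := pickP (fun a : Phi => true).
  exists (val a); first exact: valP.
  by apply: contraNneq Phi0 => <-; exact: valP.
have Phi_nil : (Phi : seq V) = [::].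
  case E : (Phi : seq V) => [//|b s].
  have bPhi : b \in Phi by rewrite -[b \in Phi]/(b \in (Phi : seq V)) E mem_head.
  by have := Phi_empty [` bPhi]%fset.
move: Phispan; rewrite Phi_nil span_nil => /(congr1 (fun U : {vspace V} => \dim U)).
by rewrite dimv0 dimvf /dim /= muln1 => n00; rewrite -n00 in n0.
Qed.

End AffineWeylGroup.

(** * Integer powers of an affine dilation *)

Section Dilations.
Context {R : realType} {n : nat}.
Variables (A : 'M[R]_n) (theta : 'cV[R]_n).
Hypothesis uA : A \in unitmx.
Local Notation D := (dilation_power A theta).

Lemma dilationK : cancel (dilation A theta) (dilation (invmx A) theta).
Proof. by move=> x; rewrite /dilation addrK mulKmx// subrK. Qed.

Lemma dilationVK : cancel (dilation (invmx A) theta) (dilation A theta).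
Proof. by move=> x; rewrite /dilation addrK mulKVmx// subrK. Qed.

Lemma dilation_powerS k x : D (k + 1) x = dilation A theta (D k x).
Proof.
case: k => [k|[|k]].
- by rewrite -PoszD addn1.
- by rewrite /= dilationVK.
- rewrite (_ : Negz k.+1 + 1 = Negz k).
    by rewrite /= dilationVK.
  by rewrite !NegzE intS opprD addrC addrA subrr add0r.
Qed.

Lemma dilation_powerD k l x : D (k + l) x = D k (D l x).
Proof.
elim/int_ind: k => [|k IH|k IH]; first by rewrite add0r.
  by rewrite intS (addrC 1) addrAC !dilation_powerS IH.
apply: (can_inj dilationK); rewrite -!dilation_powerS.
have kS : - k.+1%:Z + 1 = - k%:Z by rewrite intS opprD addrAC addNr add0r.
by rewrite addrAC kS.
Qed.

Lemma dilation_continuous (B : 'M[R]_n) : continuous (dilation B theta).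
Proof.
have [c cP] := mulmx_bounded B.
move=> x; have xF : Filter (nbhs x) := nbhs_filter x.
apply/cvgrPdist_le => e e0.
have c1 : 0 < `|c| + 1 by rewrite ltr_wpDl.
have := nbhsx_ballx x _ (divr_gt0 e0 c1).
apply: filterS => y; rewrite -ball_normE /ball_ /= => xy.
rewrite /dilation [X in `|X|](_ : _ = B *m (x - y)); last first.
  by rewrite opprD addrACA subrr addr0 -mulmxBr opprB addrA subrK.
apply: le_trans (cP _) _; apply: (@le_trans _ _ ((`|c| + 1) * `|x - y|)).
  by apply: ler_wpM2r => //; rewrite (le_trans (ler_norm c))// lerDl.
by rewrite mulrC -ler_pdivlMr//; exact: ltW.
Qed.

Lemma dilation_power_continuous k : continuous (D k).
Proof.
have iterC (f : 'cV[R]_n -> 'cV[R]_n) m : continuous f -> continuous (iter m f).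
  move=> cf; elim: m => [|m IH] x; first exact: cvg_id.
  by apply: continuous_comp; [exact: IH|exact: cf].
by case: k => m; apply: iterC; exact: dilation_continuous.
Qed.

Lemma dilation_powerNK k : cancel (D (- k)) (D k).
Proof. by move=> x; rewrite -dilation_powerD subrr. Qed.

End Dilations.

(** * Packing and tiling along an expanding gauge *)

Section Gauge.
Context {R : realType} {V : Type}.
Variables (T : int -> V -> V) (nu : V -> R) (s : R).
Hypothesis T0 : forall x, T 0 x = x.
Hypothesis TD : forall k l x, T (k + l) x = T k (T l x).
Hypothesis s1 : 1 < s.
Hypothesis nu_ge0 : forall x, 0 <= nu x.
Hypothesis nu_expand : forall x, s * nu x <= nu (T 1 x).

Lemma gauge_growth (m : nat) x : s ^+ m * nu x <= nu (T m x).
Proof.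
elim: m => [|m IH]; first by rewrite expr0 mul1r T0.
rewrite intS TD; apply: le_trans (nu_expand _).
by rewrite exprS -mulrA ler_wpM2l// ltW// (lt_trans ltr01).
Qed.

Lemma expr_unbounded (y c : R) : 0 < c -> exists m, y <= s ^+ m * c.
Proof.
move=> c0; have s0 : 0 < s := lt_trans ltr01 s1.
have y1 : 0 < `|y| + 1 by rewrite ltr_wpDl.
have /cvg_expr/cvgrPdist_lt/(_ _ (divr_gt0 c0 y1)) [m _ /(_ m (leqnn m))] :
    `|s^-1| < 1 by rewrite ger0_norm ?invr_ge0 1?ltW// invf_lt1.
rewrite sub0r normrN ger0_norm ?exprn_ge0 ?invr_ge0 1?ltW// => sm.
exists m; apply: (le_trans (ler_norm y)); move: sm.
rewrite ltr_pdivlMr// exprVn mulrC ltr_pdivrMr ?exprn_gt0// (mulrC c) => sm.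
by apply: ltW; apply: lt_trans sm; rewrite ltrDl.
Qed.

Lemma forward_packing (P : set V) :
  (forall x (m : nat), P x -> ~ P (T m.+1 x)) ->
  forall x k, P x -> P (T k x) -> k = 0.
Proof.
move=> fwd x [[//|m]|m] Px Pkx; first by have := fwd x m Px.
case: (fwd _ m Pkx).
by rewrite -TD NegzE subrr T0.
Qed.

(** One step multiplies the gauge by at least [s], which carries the annulus
    outside of itself. *)
Lemma annulus_packing (l u : R) (P : set V) : u <= s * l ->
  (forall x, P x -> l < nu x <= u) -> forall x k, P x -> P (T k x) -> k = 0.
Proof.
move=> usl Plu; apply: forward_packing => x m Px /Plu/andP[_].
apply/negP; rewrite -ltNge; apply: le_lt_trans usl _.
have /andP[lx _] := Plu _ Px; have := gauge_growth m (T 1 x).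
rewrite -TD addrC -intS; apply: lt_le_trans.
have s0 : 0 < s := lt_trans ltr01 s1.
apply: (@lt_le_trans _ _ (nu (T 1 x))).
  by apply: lt_le_trans (nu_expand x); rewrite ltr_pM2l.
by apply: ler_peMl => //; apply: exprn_ege1; exact: ltW.
Qed.

(** The crossing set: since the gauge grows by a factor [s] at every step, an
    orbit of positive gauge passes the level [r] exactly once. *)
Definition shell (r : R) : set V := [set x | nu x < r <= nu (T 1 x)].

Lemma shell_packing r x k : shell r x -> shell r (T k x) -> k = 0.
Proof.
apply: forward_packing => {}x m /andP[_ rx] /andP[+ _]; apply/negP.
rewrite -leNgt; apply: (le_trans rx); have := gauge_growth m (T 1 x).
rewrite -TD addrC -intS; apply: le_trans; apply: ler_peMl => //.
by apply: exprn_ege1; exact: ltW.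
Qed.

(** Going backwards along the orbit the gauge drops below [r]; the crossing is
    just before the first time from there on that it reaches [r]. *)
Lemma shell_covering r x : 0 < r -> 0 < nu x -> exists k, shell r (T k x).
Proof.
move=> r0 x0; have s0 : 0 < s := lt_trans ltr01 s1.
have [j xj] := expr_unbounded (nu x + 1) r0.
pose y := T (- j%:Z) x.
have yx : T j y = x by rewrite -TD subrr T0.
have yr : nu y < r.
  rewrite -(ltr_pM2l (exprn_gt0 j s0)); apply: le_lt_trans (gauge_growth j y) _.
  by rewrite yx; apply: lt_le_trans xj; rewrite ltrDl.
have ey : exists m : nat, r <= nu (T m y).
  have [m rm] := expr_unbounded r x0; exists (m + j)%N.
  by rewrite PoszD TD yx; exact: le_trans rm (gauge_growth m x).
case: (ex_minnP ey) => -[|m]; first by rewrite T0 leNgt yr.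
move=> rm m_min; have mr : nu (T m y) < r.
  by rewrite ltNge; apply/negP => /m_min; rewrite ltnn.
by exists (m%:Z - j%:Z); rewrite TD /shell /= mr -TD -intS.
Qed.
End Gauge.

(** * Measurable partitions and congruence *)

Section Congruence.
Context {R : realType} {n : nat}.
Local Notation V := 'cV[R]_n.+1.

Lemma borel_lmeasurable (X : set V) : <<s open >> X -> lmeasurable X.
Proof.
move: X; apply: smallest_sub; first exact: sigma_algebra_lmeasurable.
exact: lmeasurable_open.
Qed.

Lemma lnull_sub (X Y : set V) : X `<=` Y -> lnull Y -> lnull X.
Proof.
move=> XY Y0; apply/eqP; rewrite eq_le lebesgue_outer_ge0 andbT -Y0.
exact: le_lebesgue_outer.
Qed.

Lemma measurable_partition_exact (I : Type) (D : set I) (P : I -> set V)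
    (S : set V) :
  countable D -> (forall i, D i -> lmeasurable (P i)) ->
  (forall i j x, D i -> D j -> P i x -> P j x -> i = j) ->
  lmeasurable S -> \bigcup_(i in D) P i = S -> measurable_partition D P S.
Proof.
move=> cD mP tP mS PS; split=> // [i j Di Dj ij|].
  apply: lnull_sub (lnull_set0 _) => x [Pix Pjx].
  by apply: ij; exact: tP Pix Pjx.
by rewrite PS; exact: eq_mod_null_refl.
Qed.

Lemma lmeasurable_setU (X Y : set V) :
  lmeasurable X -> lmeasurable Y -> lmeasurable (X `|` Y).
Proof. exact: caratheodory_measurable_setU. Qed.

(** The partitions are indexed by all of [G]: the piece of index [f] collects
    whichever of the two sets are moved by [f], possibly both or none. *)
Lemma two_piece_congruent (G : set (V -> V)) (g h : V -> V) (P S : set V) :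
  countable G -> G g -> G h ->
  lmeasurable P -> lmeasurable S ->
  lmeasurable (g @` P) -> lmeasurable (h @` S) ->
  P `&` S `<=` set0 -> g @` P `&` h @` S `<=` set0 ->
  group_congruent G (P `|` S) (g @` P `|` h @` S).
Proof.
move=> cG Gg Gh mP mS mgP mhS PS0 gPhS0.
pose glue (A B : set V) f := [set x | f = g /\ A x \/ f = h /\ B x].
have mglue A B f : lmeasurable A -> lmeasurable B -> lmeasurable (glue A B f).
  have guard (Q : Prop) (X : set V) : lmeasurable X -> lmeasurable [set x | Q /\ X x].
    move=> mX; have [q|nq] := pselect Q.
      by rewrite (_ : [set x | _] = X)//; apply/seteqP; split=> x //= -[].
    rewrite (_ : [set x | _] = set0); last by apply/seteqP; split=> x //= -[].
    exact/lmeasurable_open/open0.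
  by move=> mA mB; apply: lmeasurable_setU; exact: guard.
have part A B : lmeasurable A -> lmeasurable B -> A `&` B `<=` set0 ->
    measurable_partition G (glue A B) (A `|` B).
  move=> mA mB AB0; apply: measurable_partition_exact => //.
  - by move=> f _; exact: mglue.
  - move=> f f' x _ _ [[-> Ax]|[-> Bx]] [[-> A'x]|[-> B'x]] //.
      by have := AB0 x (conj Ax B'x).
    by have := AB0 x (conj A'x Bx).
  - exact: lmeasurable_setU.
  - apply/seteqP; split=> [x [f _ [[_ ?]|[_ ?]]]|x [Ax|Bx]]; first by left.
    + by right.
    + by exists g => //; left.
    + by exists h => //; right.
exists (glue P S), (glue (g @` P) (h @` S)); split; [exact: part|exact: part|].
move=> f Gf; rewrite (_ : f @` _ = glue (g @` P) (h @` S) f).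
  exact: eq_mod_null_refl.
apply/seteqP; split=> [_ [x [[fg Px]|[fh Sx]] <-]|y [[fg [x Px <-]]|[fh [x Sx <-]]]].
- by left; split=> //; exists x => //; rewrite fg.
- by right; split=> //; exists x => //; rewrite fh.
- by exists x; [left|rewrite fg].
- by exists x; [right|rewrite fh].
Qed.

End Congruence.

(** * Far translates of a compact set *)

Section FarTranslate.
Context {R : realType} {n : nat}.
Local Notation V := 'cV[R]_n.+1.
Variables (N : V -> R) (s K : R).
Hypothesis s1 : 1 < s.
Hypothesis N_norm : forall y, `|y| <= N y <= K * `|y|.
Hypothesis ND : forall y z, N (y + z) <= N y + N z.
Hypothesis NN : forall y, N (- y) = N y.

Lemma gauge_continuous (theta : V) : continuous (fun x : V => N (x - theta)).
Proof.
move=> x; have xF : Filter (nbhs x) := nbhs_filter x.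
apply/cvgrPdist_le => e e0.
have K1 : 0 < `|K| + 1 by rewrite ltr_wpDl.
have := nbhsx_ballx x _ (divr_gt0 e0 K1).
apply: filterS => y; rewrite -ball_normE /ball_ /= => xy.
have Nxy : N (x - y) <= e.
  have /andP[_ /le_trans] := N_norm (x - y); apply.
  apply: (@le_trans _ _ ((`|K| + 1) * `|x - y|)).
    by apply: ler_wpM2r => //; rewrite (le_trans (ler_norm K))// lerDl.
  by rewrite mulrC -ler_pdivlMr//; exact: ltW.
have := ND (x - y) (y - theta); rewrite addrA subrK => Nx.
have := ND (- (x - y)) (x - theta); rewrite opprB addrA subrK -(opprB x y) NN => Ny.
rewrite ler_norml; apply/andP; split; lra.
Qed.

Lemma compact_gauge_bounded (C : set V) (theta : V) : compact C ->
  exists2 M : R, 0 <= M & forall x, C x -> N (x - theta) <= M.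
Proof.
move=> /compact_bounded[B [_ BP]].
have {}BP x : C x -> `|x| <= `|B| + 1.
  by apply: BP; rewrite ltr_pwDr// ler_norm.
exists (`|K| * (`|B| + 1 + `|theta|)); first by rewrite mulr_ge0// !addr_ge0.
move=> x Cx; have /andP[_ /le_trans] := N_norm (x - theta); apply.
apply: (@le_trans _ _ (`|K| * `|x - theta|)).
  by apply: ler_wpM2r => //; exact: ler_norm.
by rewrite ler_wpM2l// (le_trans (ler_normB _ _))// lerD2r BP.
Qed.

(** Translating by a vector [t] puts the ball [N (x - theta) <= M] between the
    levels [N t - M] and [N t + M], whose ratio gets below [s] as [N t] grows. *)
Lemma far_translate (M : R) (b : V) : b != 0 -> 0 <= M ->
  exists (k : nat) (l : R), M <= l /\ forall theta x : V, N (x - theta) <= M ->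
    l < N (x + k%:R *: b - theta) <= s * l.
Proof.
move=> b0 M0; have b_gt0 : 0 < `|b| by rewrite normr_gt0.
have s10 : 0 < s - 1 by rewrite subr_gt0.
pose c := 2 * M + 1 + (M + s * (M + 1)) / (s - 1).
pose k := Num.bound (c / `|b|); pose t := k%:R *: b.
have d0 : 0 <= (M + s * (M + 1)) / (s - 1) by rewrite divr_ge0// ?ltW//; nra.
have c0 : 0 <= c by rewrite /c; lra.
have ct : c < N t.
  have /andP[/(lt_le_trans _)+ _] := N_norm t; apply.
  rewrite normrZ ger0_norm// -ltr_pdivrMr//.
  by apply: archi_boundP; rewrite divr_ge0// ltW.
have t1 : 2 * M + 1 < N t by move: ct; rewrite /c; lra.
have t2 : M + s * (M + 1) < N t * (s - 1).
  by rewrite -ltr_pdivrMr//; move: ct; rewrite /c; lra.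
exists k, (N t - M - 1); split=> [|theta x xM]; first by lra.
rewrite [x + _ - theta]addrAC -/t; have := ND (x - theta) t.
have := ND (- (x - theta)) (x - theta + t); rewrite addKr NN.
by move=> ? ?; apply/andP; split; lra.
Qed.
End FarTranslate.

(** * Wavelet sets *)

(** The translations by multiples of [b] move the compact set [C] to where the
    orbits of the dilation cross it at most once, and the neighbourhood of
    [theta] in [C] has room for a whole transversal of these orbits; the
    exchange of the previous sections joins both. *)
Lemma expansive_wavelet_set (R : realType) n (A : 'M[R]_n.+1)
    (theta b : 'cV[R]_n.+1) (C : set 'cV[R]_n.+1)
    (W : set ('cV[R]_n.+1 -> 'cV[R]_n.+1)) :
  expansive A -> compact C -> interior C theta ->
  countable W -> W idfun -> b != 0 ->
  (forall k : nat, W (fun x => x - k%:R *: b)) ->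
  exists E, wavelet_set A theta W C E.
Proof.
move=> hA cC htheta cW W1 b0 Wb.
have uA := expansive_unitmx hA.
have [N [s [K [s1 N_norm ND NN N_expand]]]] := expansive_adapted_norm hA.
have [M M0 CM] := compact_gauge_bounded N_norm theta cC.
have [k [l [Ml far]]] := far_translate s1 N_norm ND NN b0 M0.
pose t := k%:R *: b.
pose q (x : 'cV[R]_n.+1) := x + t.
pose q' (x : 'cV[R]_n.+1) := x - t.
have qK : cancel q q' by move=> x; rewrite /q' addrK.
have q'K : cancel q' q by move=> x; rewrite /q subrK.
have shift_continuous (z : 'cV[R]_n.+1) : continuous (fun x : 'cV[R]_n.+1 => x + z).
  move=> x; have xF : Filter (nbhs x) := nbhs_filter x.
  exact: (cvgD (@cvg_id _ (nbhs x)) (cvg_cst z)).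
pose D := dilation_power A theta.
pose nu x := N (x - theta).
have nu_ge0 x : 0 <= nu x.
  by have /andP[+ _] := N_norm (x - theta); apply: le_trans.
have nu_expand x : s * nu x <= nu (D 1 x).
  by rewrite /nu /D /= /dilation addrK; exact: N_expand.
have D0 x : D 0 x = x by [].
have DD i j x : D (i + j) x = D i (D j x) by exact: dilation_powerD.
have [r r0 rC] : exists2 r, 0 < r & forall x, nu x < r -> C x.
  have /nbhs_ballP[r /= r0 rC] := htheta.
  exists r => // x xr; apply: rC; rewrite -ball_normE /ball_ /= distrC.
  by apply: le_lt_trans xr; have /andP[] := N_norm (x - theta).
(* [Y] is a transversal of the dilation inside [C]; [X] is a translate
   of [C], far enough out to meet every orbit at most once. *)
pose Y := shell D nu r; pose X := q @` C.
have YC : Y `<=` C by move=> x /andP[/rC].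
have qYX : q @` Y `<=` X by move=> _ [x /YC Cx <-]; exists x.
have Xlu x : X x -> l < nu x <= s * l by move=> [y /CM/far + <-].
have CX : C `&` X `<=` set0.
  move=> x [/CM xM /Xlu /andP[+ _]]; apply/negP.
  by rewrite -leNgt; exact: le_trans Ml.
have X_packing := annulus_packing D0 DD s1 nu_ge0 nu_expand (lexx _) Xlu.
have Y_packing := @shell_packing _ _ D nu s D0 DD s1 nu_ge0 nu_expand r.
have bX : <<s open >> X.
  rewrite /X (image_can qK q'K); apply: borel_preimage.
    exact: shift_continuous.
  by apply: borel_closed; apply: compact_closed.
have bY : <<s open >> Y.
  have oB : open [set x | nu x < r].
    apply: (@open_comp _ _ nu [set y | y < r]); last exact: open_lt.
    by move=> x _; exact: (gauge_continuous N_norm ND NN).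
  rewrite (_ : Y = [set x | nu x < r] `\` D 1 @^-1` [set x | nu x < r]).
    apply: borel_setD; first exact: borel_open.
    apply: borel_preimage; first exact: dilation_power_continuous.
    exact: borel_open.
  apply/seteqP; split=> x /=.
    by move=> /andP[-> xr]; split=> //; apply/negP; rewrite -leNgt.
  by move=> [xr /negP]; rewrite -leNgt /Y /shell /= xr => ->.
pose S := exchange_set D q X Y; pose P := Y `\` orbit_trace D Y S.
pose E := simultaneous_transversal D q X Y.
have [bS btr] : <<s open >> S /\ <<s open >> (orbit_trace D Y S).
  apply: (@borel_exchange_set _ D q q') => //.
  - by move=> i; exact: dilation_power_continuous.
  - by move=> i; exact: dilation_powerNK.
  - exact: shift_continuous.
have bP : <<s open >> P by exact: borel_setD.
have bE : <<s open >> E by exact: borel_setU.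
have SX : S `<=` X by exact: exchange_set_sub.
have XS : X `\` S = q @` P by apply: exchange_setD => //; exact: can_inj qK.
exists E; split; first exact: borel_lmeasurable.
- rewrite /E /simultaneous_transversal -/S -/P.
  have Cq : q' @` S `|` idfun @` P = C.
    rewrite image_id; apply/seteqP; split=> [x [[y /SX[z Cz <-] <-]|[/YC]]|x Cx] //.
      by rewrite qK.
    have [Sqx|nSqx] := pselect (S (q x)); first by left; exists (q x).
    right; have : (X `\` S) (q x) by split=> //; exists x.
    by rewrite XS => -[y Py] /(can_inj qK) <-.
  rewrite -Cq; apply: two_piece_congruent.
  + exact: cW.
  + exact: Wb.
  + exact: W1.
  + exact: borel_lmeasurable.
  + exact: borel_lmeasurable.
  + apply: borel_lmeasurable; rewrite (image_can q'K qK).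
    by apply: borel_preimage bS; exact: shift_continuous.
  + by rewrite image_id; exact: borel_lmeasurable.
  + by move=> x [/SX Xx [/YC Cx _]]; apply: CX; split; [exact: Cx|].
  + rewrite image_id => _ [[y Sy <-] Py].
    have : (q @` P) y by exists (q' y).
    by rewrite -XS => -[].
- have DE i (B : set 'cV[R]_n.+1) : D i @` B = D (- i) @^-1` B.
    by apply: image_can => x; rewrite -DD ?addNr ?subrr.
  have DEE i : <<s open >> (D i @` E).
    by rewrite DE; apply: borel_preimage => //; exact: dilation_power_continuous.
  split.
  + exact: countableP.
  + by apply: borel_lmeasurable; exact: borel_open openT.
  + by move=> i _; exact: borel_lmeasurable.
  + move=> i j _ _ ij; apply: lnull_sub (lnull_set0 _) => x.
    rewrite !DE => -[/= Eix Ejx]; apply: ij.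
    suff : i - j = 0 by move/subr0_eq.
    apply: (simultaneous_transversal_packing D0 DD qYX X_packing Y_packing Eix).
    by rewrite -DD addrAC subrr add0r.
  (* The dilates miss the centre, which is its own orbit. *)
  + apply: lnull_sub (lnull_set1 theta) => x [[_ []//]|[_ nx]].
    apply: contrapT => x_theta; apply: nx.
    have nux : 0 < nu x.
      have /andP[+ _] := N_norm (x - theta); apply: lt_le_trans.
      by rewrite normr_gt0 subr_eq0; exact/eqP.
    have [i Yi] := shell_covering D0 DD s1 nu_expand r0 nux.
    have [j Ej] := simultaneous_transversal_covering q X D0 DD Yi.
    exists (- j) => //; exists (D j x) => //.
    by rewrite -[LHS]/(D (- j) (D j x)) -DD addNr.
Qed.

Theorem theorem12 (R : realType) (n : nat) (hn : (0 < n)%N)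
    (Phi : {fset 'cV[R]_n}) (hPhi : root_system Phi)
    (C : set 'cV[R]_n)
    (hCfund : fundamental_domain (affine_weyl_group Phi) C)
    (hCfold : foldable_figure C)
    (theta : 'cV[R]_n) (htheta : interior C theta)
    (A : 'M[R]_n) (hA : expansive A) :
  exists E : set 'cV[R]_n, wavelet_set A theta (affine_weyl_group Phi) C E.
Proof.
case: n hn Phi hPhi C hCfund hCfold theta htheta A hA => [//|n] hn Phi hPhi C _.
move=> [cC _ _] theta htheta A hA.
have [a aPhi a0] := root_system_has_root hn hPhi.
apply: (@expansive_wavelet_set _ _ _ _ (coroot a)) => //.
- by apply: countable_affine_weyl_group; case: hPhi.
- exact: affine_weyl_idfun.
- exact: coroot_neq0.
- move=> k; have := affine_weyl_translation (- k%:Z) aPhi a0.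
  by rewrite rmorphN /= scaleNr.
Qed.
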